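(* Let $\mathcal{H}$ be a hypothesis class of functions $\mathcal{X}\to\mathcal{Y}$ and let $\ell:\mathcal{Y}\times\mathcal{Y}\to[0,1]$ be a loss function that is a metric on $\mathcal{Y}$. If $\mathrm{Cdim}(\mathcal{H})$ is finite then $\tau(\mathcal{H})\le 6\cdot\mathrm{Cdim}(\mathcal{H})$.
   Context: $d_\infty(f_1,f_2)=\sup_{x\in\mathcal{X}}\ell(f_1(x),f_2(x))$. $N_\varepsilon(\mathcal{H})$ is a minimum-cardinality set $S\subseteq\mathcal{H}$ such that each $h\in\mathcal{H}$ has $h'\in S$ with $d_\infty(h,h')\le\varepsilon$; $\mathrm{Cdim}(\mathcal{H})=\sup_{0<\varepsilon\le1/2}\log|N_\varepsilon(\mathcal{H})|/\log(1/\varepsilon)$. An $(\mathcal{X},\mathcal{Y})$-tree of cost $c$ is a rooted binary tree in which each interior node has two children and is labeled by a triple $(x,y_1,y_2)$ with $x\in\mathcal{X}$, $y_1,y_2\in\mathcal{Y}$, such that for every leaf, the sum of $\ell(y_1,y_2)$ over the interior nodes on the root-to-leaf path is at least $c$. Such a tree is $\mathcal{H}$-satisfiable if each leaf can be labeled by some $f\in\mathcal{H}$ so that for each interior node $(x,y_1,y_2)$, all leaves in its left subtree satisfy $f(x)=y_1$ and all leaves in its right subtree satisfy $f(x)=y_2$. The tree dimension $\tau(\mathcal{H})$ is the maximum cost of an $\mathcal{H}$-satisfiable $(\mathcal{X},\mathcal{Y})$-tree. *)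

(* Defs.v *)
From mathcomp Require Import all_boot all_order all_algebra.
From mathcomp Require Import all_classical all_reals all_analysis.

Set Implicit Arguments.
Unset Strict Implicit.
Unset Printing Implicit Defensive.

Import Order.TTheory GRing.Theory Num.Theory.

Local Open Scope classical_set_scope.
Local Open Scope ring_scope.

Record is_metric (R : realType) (Y : Type) (l : Y -> Y -> R) : Prop := IsMetric {
  is_metric_ge0 : forall y1 y2, 0 <= l y1 y2;
  is_metric_eq0 : forall y1 y2, l y1 y2 = 0 <-> y1 = y2;
  is_metric_sym : forall y1 y2, l y1 y2 = l y2 y1;
  is_metric_triangle : forall y1 y2 y3, l y1 y3 <= l y1 y2 + l y2 y3
}.

(* For a [0, 1]-valued [l] the real [sup] is the genuine supremum; it is 0 when
   [X] is empty. *)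
Definition dinf (R : realType) (X Y : Type) (l : Y -> Y -> R)
    (f1 f2 : X -> Y) : R :=
  sup (range (fun x => l (f1 x) (f2 x))).

Definition is_cover (R : realType) (X Y : Type) (l : Y -> Y -> R)
    (H : set (X -> Y)) (eps : R) (S : set (X -> Y)) : Prop :=
  S `<=` H /\ forall h, H h -> exists2 h', S h' & dinf l h h' <= eps.

(* The minimal cardinality of a cover, with all infinite cardinals identified
   with +oo: the infimum is attained if there is a finite cover, and is that of
   the empty set, +oo, otherwise. *)
Definition covering_number (R : realType) (X Y : Type) (l : Y -> Y -> R)
    (H : set (X -> Y)) (eps : R) : \bar R :=
  ereal_inf [set n%:R%:E | n in
    [set n : nat | exists S, is_cover l H eps S /\ (S #= `I_n)%card]].

(* The ratio does not depend on the base of the logarithm; [lne +oo = +oo], and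
   [lne 0 = -oo] (relevant only when [H] is empty). *)
Definition Cdim (R : realType) (X Y : Type) (l : Y -> Y -> R)
    (H : set (X -> Y)) : \bar R :=
  ereal_sup [set (lne (covering_number l H eps) * ((ln (1 / eps))^-1)%:E)%E |
    eps in [set eps : R | 0 < eps <= 1 / 2]].

(* Being inductive, these trees are finite. *)
Inductive tree (X Y : Type) : Type :=
| Leaf
| Node of X & Y & Y & tree X Y & tree X Y.
Arguments Leaf {X Y}.
Arguments Node {X Y}.

Fixpoint leaves (X Y : Type) (t : tree X Y) : Type :=
  match t with
  | Leaf => unit
  | Node _ _ _ tl tr => (leaves tl + leaves tr)%type
  end.

(* Sum of [l y1 y2] over the interior nodes on the path from the root to the
   given leaf. *)
Fixpoint path_cost (R : realType) (X Y : Type) (l : Y -> Y -> R)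
    (t : tree X Y) : leaves t -> R :=
  match t return leaves t -> R with
  | Leaf => fun=> 0
  | Node _ y1 y2 tl tr => fun v =>
      l y1 y2 + match v with
                | inl v' => path_cost l v'
                | inr v' => path_cost l v'
                end
  end.

Definition has_cost (R : realType) (X Y : Type) (l : Y -> Y -> R)
    (t : tree X Y) (c : R) : Prop :=
  forall v : leaves t, c <= path_cost l v.

Fixpoint consistent (X Y : Type) (t : tree X Y) :
    (leaves t -> X -> Y) -> Prop :=
  match t return (leaves t -> X -> Y) -> Prop with
  | Leaf => fun=> True
  | Node x y1 y2 tl tr => fun lab =>
      [/\ forall v : leaves tl, lab (inl v) x = y1,
          forall v : leaves tr, lab (inr v) x = y2,
          @consistent X Y tl (fun v => lab (inl v)) &
          @consistent X Y tr (fun v => lab (inr v))]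
  end.

Definition satisfiable (X Y : Type) (H : set (X -> Y)) (t : tree X Y) : Prop :=
  exists lab : leaves t -> X -> Y,
    (forall v, H (lab v)) /\ @consistent X Y t lab.

(* The maximum cost is taken as a supremum in the extended reals, since it may
   be infinite or not attained. *)
Definition tree_dim (R : realType) (X Y : Type) (l : Y -> Y -> R)
    (H : set (X -> Y)) : \bar R :=
  ereal_sup [set c%:E | c in
    [set c : R | exists t : tree X Y, has_cost l t c /\ satisfiable H t]].

(* Main.v *)
Require Import Defs.
From mathcomp Require Import all_boot all_order all_algebra.
From mathcomp Require Import all_classical all_reals all_analysis.
From mathcomp Require Import lra.

Set Implicit Arguments.
Unset Strict Implicit.
Unset Printing Implicit Defensive.

Import Order.TTheory GRing.Theory Num.Theory.

Local Open Scope classical_set_scope.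
Local Open Scope ring_scope.

(** At scale [eps], two leaves of a satisfiable tree that separate at a node of
    weight [w > 2 eps] need distinct elements of an [eps]-cover. Keeping both
    subtrees at such nodes and only the better one elsewhere therefore bounds
    the covering number from below by a leaf count [P_eps]. Take the potential
    [\sum_k 2^-k * ln P_(2^-k)] over the dyadic scales: by concavity of [ln],
    its value at a node exceeds the average over the two children by [ln 2]
    times the sum of the [2^-k < w / 2], which is at least [w / 2 - 2^-K] when
    only the scales [k <= K] are used. Letting [K] tend to infinity on a fixed
    tree, the potential is at least [(ln 2 / 2) * cost]; it is at most
    [Cdim * ln 2 * \sum_k k * 2^-k = 2 * ln 2 * Cdim]; hence
    [cost <= 4 * Cdim]. *)

Fixpoint separated_leaves (R : realType) (X Y : Type) (l : Y -> Y -> R)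
    (eps : R) (t : tree X Y) : nat :=
  match t with
  | Leaf => 1
  | Node _ y1 y2 tl tr =>
      if 2 * eps < l y1 y2
      then (separated_leaves l eps tl + separated_leaves l eps tr)%N
      else maxn (separated_leaves l eps tl) (separated_leaves l eps tr)
  end.

Section SeparatedLeaves.
Context {R : realType} {X Y : Type} {l : Y -> Y -> R}.
Implicit Types (t : tree X Y) (eps : R) (H S : set (X -> Y)).

Lemma separated_leaves_gt0 eps t : (0 < separated_leaves l eps t)%N.
Proof.
elim: t => //= x y1 y2 tl IHl tr IHr; case: ifP => _.
  by rewrite addn_gt0 IHl.
by rewrite leq_max IHl.
Qed.

(** Induction on the tree. At a node with [2 * eps < l y1 y2], labels from the two sides take the
    values [y1] and [y2] at [x], so [g] never agrees across sides and the two image sets are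
    disjoint. Requiring [A] to consist of values of [g] lets this argument pass through the
    induction. *)
Lemma separated_leaves_le_image (I : finType) eps t
    (lab : leaves t -> X -> Y) (g : leaves t -> I) :
  consistent lab ->
  (forall v v' x, g v = g v' -> l (lab v x) (lab v' x) <= 2 * eps) ->
  exists2 A : {set I}, (separated_leaves l eps t <= #|A|)%N &
    forall i, i \in A -> exists v, g v = i.
Proof.
elim: t lab g => [|x y1 y2 tl IHl tr IHr] lab g /=.
  move=> _ _; exists [set g tt]%SET; first by rewrite cards1.
  by move=> i; rewrite finset.inE => /eqP ->; exists tt.
move=> [labl labr cl cr] sep.
have [|Al leAl Al_im] := IHl _ (fun v => g (inl v)) cl.
  by move=> v v' z; exact: sep.
have [|Ar leAr Ar_im] := IHr _ (fun v => g (inr v)) cr.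
  by move=> v v' z; exact: sep.
have Al_img i : i \in Al -> exists v, g v = i.
  by move=> /Al_im[v <-]; exists (inl v).
have Ar_img i : i \in Ar -> exists v, g v = i.
  by move=> /Ar_im[v <-]; exists (inr v).
case: ifPn => [w_gt|_]; last first.
  by case: (leqP (separated_leaves l eps tl)) => _; [exists Ar|exists Al].
exists (Al :|: Ar)%SET; last first.
  by move=> i; rewrite finset.inE => /orP[/Al_img|/Ar_img].
have disj : [disjoint Al & Ar]%B.
  apply/pred0P => i /=; apply/negP => /andP[/Al_im[v gv] /Ar_im[v' gv']].
  have := sep (inl v) (inr v') x (etrans gv (esym gv')).
  by rewrite labl labr leNgt w_gt.
by rewrite cardsU (disjoint_setI0 disj) cards0 subn0 leq_add.
Qed.

Lemma loss_le_dinf (f1 f2 : X -> Y) x :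
  (forall y1 y2, l y1 y2 <= 1) -> l (f1 x) (f2 x) <= dinf l f1 f2.
Proof.
move=> l1; apply: ub_le_sup; last by exists x.
by exists 1 => _ [z _ <-].
Qed.

(** Each leaf is sent to the index of a cover element within [eps] of its label; by the triangle
    inequality, leaves with the same index have labels within [2 * eps] at every point. *)
Lemma separated_leaves_le_cover H S eps n t :
  (forall y1 y2, l y1 y2 <= 1) -> is_metric l -> satisfiable H t ->
  is_cover l H eps S -> (S #= `I_n)%card -> (separated_leaves l eps t <= n)%N.
Proof.
move=> l1 lm [lab [Hlab clab]] [SH cov] /card_set_bijP[f [fS finj _]].
have /choice[c cP] v : exists h, S h /\ dinf l (lab v) h <= eps.
  by have [h Sh dh] := cov _ (Hlab v); exists h.
have fc v : (f (c v) < n)%N by apply: fS; exact: (cP v).1.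
have [v v' x [fvv']|A leA _] :=
    separated_leaves_le_image (eps := eps) (g := fun v => Ordinal (fc v)) clab.
  have cvv' : c v = c v'.
    by apply: finj => //; rewrite inE; [exact: (cP v).1|exact: (cP v').1].
  have dv : l (lab v x) (c v x) <= eps.
    exact: le_trans (loss_le_dinf _ _ _ l1) (cP v).2.
  have dv' : l (lab v' x) (c v x) <= eps.
    by rewrite cvv'; exact: le_trans (loss_le_dinf _ _ _ l1) (cP v').2.
  have := is_metric_triangle lm (lab v x) (c v x) (lab v' x).
  rewrite (is_metric_sym lm (c v x)); lra.
by rewrite (leq_trans leA)// -[leqRHS]card_ord max_card.
Qed.

Lemma ln_separated_leaves_le H eps t (d : R) :
  (forall y1 y2, l y1 y2 <= 1) -> is_metric l -> satisfiable H t ->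
  Cdim l H = d%:E -> 0 < eps <= 1 / 2 ->
  ln (separated_leaves l eps t)%:R <= d * ln (1 / eps).
Proof.
move=> l1 lm tH dE eps12.
have P_gt0 : 0 < (separated_leaves l eps t)%:R :> R.
  by rewrite ltr0n separated_leaves_gt0.
have lneps_gt0 : 0 < ln (1 / eps).
  by case/andP: eps12 => ? ?; rewrite ln_gt0// ltr_pdivlMr; lra.
(* This also holds without a finite cover, where the infimum is [+oo]. *)
have covP : ((separated_leaves l eps t)%:R%:E <= covering_number l H eps)%E.
  apply: le_ereal_inf_tmp => _ [n [S [covS Sn]] <-].
  by rewrite lee_fin ler_nat (separated_leaves_le_cover l1 lm tH covS Sn).
have lnP : ((ln (separated_leaves l eps t)%:R)%:E
            <= lne (covering_number l H eps))%E.
  rewrite -lne_EFin// lee_lne// in_itv/= leey andbT.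
    by rewrite lee_fin ltW.
  by apply: le_trans covP; rewrite lee_fin ltW.
have : (lne (covering_number l H eps) * ((ln (1 / eps))^-1)%:E <= d%:E)%E.
  by rewrite -dE; apply: ereal_sup_ubound; exists eps.
move=> /(le_trans (lee_wpmul2r _ lnP)).
rewrite lee_fin invr_ge0 => /(_ (ltW lneps_gt0)).
by rewrite -EFinM lee_fin ler_pdivrMr.
Qed.

Lemma ln_add_ge_average (a b : R) : 0 < a -> 0 < b ->
  (ln a + ln b) / 2 + ln 2 <= ln (a + b).
Proof.
move=> a0 b0.
have ab0 : 0 < a * b by rewrite mulr_gt0.
have abD0 : 0 < a + b by rewrite addr_gt0.
(* Doubled and exponentiated, the claim is the AM-GM inequality, that is, [0 <= (a - b) ^+ 2]. *)
suff : ln (a * b * (2 * 2)) <= ln ((a + b) * (a + b)).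
  by rewrite !(lnM, posrE, mulr_gt0)// => ?; lra.
rewrite ler_ln ?posrE ?mulr_gt0//.
by have := sqr_ge0 (a - b); rewrite !expr2; lra.
Qed.

Lemma ln_separated_leaves_node eps x y1 y2 (tl tr : tree X Y) :
  (ln (separated_leaves l eps tl)%:R + ln (separated_leaves l eps tr)%:R) / 2
    + (if 2 * eps < l y1 y2 then ln 2 else 0)
  <= ln (separated_leaves l eps (Node x y1 y2 tl tr))%:R :> R.
Proof.
rewrite /=; set a := separated_leaves l eps tl.
set b := separated_leaves l eps tr.
have a0 : 0 < a%:R :> R by rewrite ltr0n separated_leaves_gt0.
have b0 : 0 < b%:R :> R by rewrite ltr0n separated_leaves_gt0.
case: ifP => _; first by rewrite natrD ln_add_ge_average.
have [ab|ba] := leqP a b.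
  have : ln a%:R <= ln b%:R :> R by rewrite ler_ln ?posrE// ler_nat.
  lra.
have : ln b%:R <= ln a%:R :> R by rewrite ler_ln ?posrE// ler_nat ltnW.
lra.
Qed.

Lemma exp2VS (k : nat) : 2 ^- k.+1 = 2 ^- k / 2 :> R.
Proof. by rewrite exprS invfM mulrC. Qed.

(** If the new scale counts, both sides grow by [2 ^- K.+1]; if not, [w / 2 <= 2 ^- K.+1] and the
    left side is nonpositive. *)
Lemma sum_dyadic_below (w : R) (K : nat) : w <= 1 ->
  w / 2 - 2 ^- K <=
  \sum_(k < K) 2 ^- k.+1 * (if 2 * 2 ^- k.+1 < w then 1 else 0).
Proof.
move=> w1; elim: K => [|K IH]; first by rewrite big_ord0 expr0 invr1; lra.
rewrite big_ord_recr /= exp2VS; case: ifPn => [_|].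
  by rewrite mulr1; lra.
rewrite -leNgt mulr0 addr0 => w_le.
apply: (@le_trans _ _ 0); first by lra.
by apply: sumr_ge0 => k _; case: ifP; rewrite ?mulr0// mulr1 invr_ge0 exprn_ge0.
Qed.

Lemma sum_dyadic_index (K : nat) :
  \sum_(k < K) 2 ^- k.+1 * k.+1%:R = 2 - (K + 2)%:R * 2 ^- K :> R.
Proof.
elim: K => [|K IH]; first by rewrite big_ord0 expr0 invr1; lra.
by rewrite big_ord_recr /= IH exp2VS !natrD -[K.+1%:R]natr1; lra.
Qed.

(** The scales start at 1/2, the largest one that [Cdim] controls. *)
Definition potential (K : nat) t : R :=
  \sum_(k < K) 2 ^- k.+1 * ln (separated_leaves l (2 ^- k.+1) t)%:R.

Lemma potential_node K x y1 y2 tl tr : l y1 y2 <= 1 ->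
  (potential K tl + potential K tr) / 2 + ln 2 * (l y1 y2 / 2 - 2 ^- K)
  <= potential K (Node x y1 y2 tl tr).
Proof.
move=> w1.
have ln20 : 0 <= ln 2 :> R by rewrite ln_ge0// ler1n.
apply: le_trans (_ : _ <= (potential K tl + potential K tr) / 2 + ln 2 * _) _.
  by rewrite lerD2l; exact: ler_wpM2l ln20 _ _ (sum_dyadic_below K w1).
rewrite /potential -big_split/= mulr_suml mulr_sumr -big_split/=.
apply: ler_sum => k _.
rewrite -mulrDr -mulrA [ln 2 * _]mulrCA -mulrDr.
rewrite ler_wpM2l ?invr_ge0 ?exprn_ge0//.
apply: le_trans (ln_separated_leaves_node _ x _ _ _ _).
by case: ifP; rewrite ?mulr1 ?mulr0.
Qed.

(** [D] is chosen before [K], so that the error vanishes on a fixed tree as [K] grows. *)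
Lemma potential_ge_cost t : (forall y1 y2, l y1 y2 <= 1) ->
  exists D : nat, forall K c, has_cost l t c ->
    ln 2 * (c / 2 - D%:R * 2 ^- K) <= potential K t.
Proof.
move=> l1; have ln20 : 0 <= ln 2 :> R by rewrite ln_ge0// ler1n.
elim: t => [|x y1 y2 tl [Dl IHl] tr [Dr IHr]].
  exists 0%N => K c /(_ tt) /= c0.
  rewrite /potential big1 => [|k _]; last by rewrite /= ln1 mulr0.
  by rewrite mul0r subr0 mulr_ge0_le0//; lra.
(* The node adds one error [2 ^- K]; those of the children are averaged, hence at most their sum. *)
exists (Dl + Dr).+1 => K c hc.
apply: le_trans (potential_node _ x _ _ (l1 _ _)).
have costl : has_cost l tl (c - l y1 y2).
  by move=> v; have := hc (inl v) => /=; lra.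
have costr : has_cost l tr (c - l y1 y2).
  by move=> v; have := hc (inr v) => /=; lra.
have := IHl K _ costl; have := IHr K _ costr.
have : 0 <= ln 2 * (Dl%:R * 2 ^- K) :> R.
  by rewrite !mulr_ge0 ?invr_ge0 ?exprn_ge0.
have : 0 <= ln 2 * (Dr%:R * 2 ^- K) :> R.
  by rewrite !mulr_ge0 ?invr_ge0 ?exprn_ge0.
rewrite -[(Dl + Dr).+1%:R]natr1 natrD; lra.
Qed.

Lemma potential_le_Cdim H K t (d : R) :
  (forall y1 y2, l y1 y2 <= 1) -> is_metric l -> satisfiable H t ->
  0 <= d -> Cdim l H = d%:E -> potential K t <= 2 * d * ln 2.
Proof.
move=> l1 lm tH d0 dE; have ln20 : 0 <= ln 2 :> R by rewrite ln_ge0// ler1n.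
apply: (@le_trans _ _ (d * ln 2 * \sum_(k < K) 2 ^- k.+1 * k.+1%:R)).
  rewrite mulr_sumr; apply: ler_sum => k _.
  rewrite mulrCA ler_wpM2l ?invr_ge0 ?exprn_ge0//.
  have -> : d * ln 2 * k.+1%:R = d * ln (1 / 2 ^- k.+1).
    by rewrite div1r invrK lnXn// -mulrA mulr_natr.
  apply: ln_separated_leaves_le tH dE _ => //.
  rewrite invr_gt0 exprn_gt0//= div1r lef_pV2 ?posrE ?exprn_gt0//.
  by rewrite exprS ler_peMr// exprn_ege1// ler1n.
rewrite sum_dyadic_index mulrC -mulrA ler_wpM2r ?mulr_ge0//.
by rewrite gerBl mulr_ge0// invr_ge0 exprn_ge0.
Qed.

(** A satisfiable tree rules out the empty class, whose [Cdim] is [-oo]: at scale 1/2 the leaf count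
    is at least 1, with nonnegative logarithm. *)
Lemma Cdim_ge0 H t (d : R) :
  (forall y1 y2, l y1 y2 <= 1) -> is_metric l -> satisfiable H t ->
  Cdim l H = d%:E -> 0 <= d.
Proof.
move=> l1 lm tH dE.
have : 0 <= d * ln (1 / (1 / 2)).
  apply: le_trans (_ : _ <= ln (separated_leaves l (1 / 2) t)%:R) _.
    by rewrite ln_ge0// ler1n separated_leaves_gt0.
  by apply: ln_separated_leaves_le tH dE _ => //; rewrite lexx andbT.
by rewrite !div1r invrK pmulr_lge0// ln_gt0// ltr1n.
Qed.

Lemma cost_le_4Cdim H t (c d : R) :
  (forall y1 y2, l y1 y2 <= 1) -> is_metric l -> satisfiable H t ->
  Cdim l H = d%:E -> has_cost l t c -> c <= 4 * d.
Proof.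
move=> l1 lm tH dE hc; have d0 := Cdim_ge0 l1 lm tH dE.
have ln20 : 0 < ln 2 :> R by rewrite ln_gt0// ltr1n.
have [D DP] := potential_ge_cost t l1.
(* This [K] makes [2 ^+ K] exceed [2 * D%:R / e]. *)
apply/ler_addgt0Pr => e e0; set K := Num.bound (2 * D%:R / e).
have DK : 2 * (D%:R * 2 ^- K) < e.
  rewrite mulrA ltr_pdivrMr ?exprn_gt0// [ltRHS]mulrC -ltr_pdivrMr//.
  exact: upper_nthrootP.
have := le_trans (DP K c hc) (potential_le_Cdim K l1 lm tH d0 dE).
by rewrite mulrC ler_pM2r//; lra.
Qed.

End SeparatedLeaves.

Theorem mainTheorem6 (R : realType) (X Y : Type) (H : set (X -> Y))
    (l : Y -> Y -> R)
    (hl01 : forall y1 y2 : Y, 0 <= l y1 y2 <= 1)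
    (hl : is_metric l)
    (hC : Cdim l H \is a fin_num) :
  (tree_dim l H <= 6%:E * Cdim l H)%E.
Proof.
have l1 y1 y2 : l y1 y2 <= 1 by case/andP: (hl01 y1 y2).
have dE := esym (fineK hC); set d := fine _ in dE.
apply: ge_ereal_sup => _ [c [t [hc tH]] <-].
rewrite dE -EFinM lee_fin.
(* Nonnegativity of [d] relaxes the bound [4 * d] to [6 * d]. *)
have := Cdim_ge0 l1 hl tH dE.
have := cost_le_4Cdim l1 hl tH dE hc.
lra.
Qed.
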